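(* For a positive integer $n$, let $g(n)$ denote the largest integer $t$ for which there exist integers $0<a_1<a_2<\cdots<a_t\le n$ such that $P(a_i)>P(a_{i+1})$ for all $1\le i\le t-1$, where $P(m)$ denotes the largest prime divisor of $m$. Then $g(n)=\Theta\left(\left(\frac{n}{\log n}\right)^{1/2}\right)$; that is, there exist constants $C_1,C_2>0$ such that $C_1\left(\frac{n}{\log n}\right)^{1/2}\le g(n)\le C_2\left(\frac{n}{\log n}\right)^{1/2}$ for all sufficiently large $n$.
   Context: For an integer $m\ge 2$, $P(m)=\max\{p : p \text{ prime and } p\mid m\}$ denotes the largest prime factor of $m$. $\log$ denotes the natural logarithm. *)

(* Defs.v *)
From mathcomp Require Import all_boot.

Set Implicit Arguments.
Unset Strict Implicit.
Unset Printing Implicit Defensive.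

(* [max_pdiv m] is P(m) for m >= 2. P(1) is undefined, while [max_pdiv 1] = 1;
   as the least term comes first, 1 can only occur as a chain of
   length one, so this affects g only at n = 1. *)
Definition P_decreasing_chain (n : nat) (s : seq nat) : bool :=
  [&& all (fun a => 0 < a <= n) s,
      sorted (fun a b => a < b) s &
      sorted (fun a b => max_pdiv a > max_pdiv b) s].

Definition has_chain (n t : nat) : bool :=
  [exists s : t.-tuple 'I_n.+1, P_decreasing_chain n (map val s)].

(* A chain has at most n terms, so the range t <= n is no restriction;
   see [g_max]. *)
Definition g (n : nat) : nat := \max_(t < n.+1 | has_chain n t) t.

Lemma P_decreasing_chain_size n s : P_decreasing_chain n s -> size s <= n.
Proof.
case/and3P=> /allP s_n lt_s _.
have us : uniq s := sorted_uniq ltn_trans ltnn lt_s.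
rewrite -[n in _ <= n](size_iota 1); apply: uniq_leq_size us _ => a /s_n.
by rewrite mem_iota add1n ltnS.
Qed.

Lemma has_chainP n t :
  reflect (exists2 s, size s = t & P_decreasing_chain n s) (has_chain n t).
Proof.
apply: (iffP existsP) => [[s cs]|[s <- cs]].
  by exists (map val s); rewrite // size_map size_tuple.
have valE : map val (map (@inord n) s) = s.
  rewrite -map_comp -[RHS]map_id; apply/eq_in_map => a sa /=.
  by case/and3P: cs => /allP/(_ a sa)/andP[_ an] _ _; rewrite inordK ?ltnS.
have sz : size (map (@inord n) s) == size s by rewrite size_map.
by exists (Tuple sz); rewrite valE.
Qed.

Lemma g_attained n : exists2 s, size s = g n & P_decreasing_chain n s.
Proof.
have h0 : has_chain n (@ord0 n) by apply/has_chainP; exists [::].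
by rewrite /g (bigmax_eq_arg ord0) //; case: arg_maxnP => // t /has_chainP.
Qed.

Lemma g_max n s : P_decreasing_chain n s -> size s <= g n.
Proof.
move=> cs; have sn := P_decreasing_chain_size cs.
have lt_sn : size s < n.+1 by [].
apply: (@leq_bigmax_cond _ _ _ (Ordinal lt_sn)) => /=.
by apply/has_chainP; exists s.
Qed.

(* Main.v *)
(** Write a term of a chain as a = m * P(a).  Along the chain P(a) decreases
    and a increases, so m increases strictly; hence at most n / y terms have
    P(a) > y, and at most pi(y) + 1 have P(a) <= y.  Taking y = sqrt (n log n),
    Chebyshev's upper bound on pi(y) gives g(n) = O(sqrt (n / log n)).

    Conversely, run downwards through primes p of (sqrt n, y], each time taking
    the least multiple of p that exceeds the previous term.  A term exceeds its
    predecessor by at most p <= y, so n / y terms stay below n; and a multiple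
    m * p <= n of p > sqrt n has m < p, hence largest prime factor p.
    Chebyshev's lower bound supplies enough primes when y ~ 2 sqrt (n log n).

    Both Chebyshev bounds come from the binomial coefficient 'C(2m, m): it is
    divisible by every prime of (m, 2m], and every prime power dividing it is at
    most 2m. *)
Require Import Defs.
From mathcomp Require Import all_boot all_order all_algebra.
From mathcomp Require Import all_classical all_reals all_analysis.
From mathcomp Require Import zify ring lra.

Set Implicit Arguments.
Unset Strict Implicit.
Unset Printing Implicit Defensive.

Import Order.TTheory GRing.Theory Num.Theory.

(** * Central binomial coefficients and Chebyshev's upper bound *)

Lemma bin_leq_exp2 n m : 'C(n, m) <= 2 ^ n.
Proof.
elim: n m => [|n IHn] [|m] //; first by rewrite bin0 expn_gt0.
by rewrite binS expnS mul2n -addnn leq_add.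
Qed.

(** By Pascal's rule and symmetry, 'C(2m+2, m+1) is twice 'C(2m+1, m), which is at least 'C(2m,
    m). *)
Lemma exp2_leq_central_bin m : 2 ^ m <= 'C(m.*2, m).
Proof.
elim: m => // m IHm; rewrite doubleS binS.
have -> : 'C(m.*2.+1, m.+1) = 'C(m.*2.+1, m).
  by rewrite -[in LHS]bin_sub; [congr 'C(_, _); lia|lia].
rewrite addnn expnS mul2n leq_double (leq_trans IHm) //.
by case: m {IHm} => // m; rewrite binS leq_addr.
Qed.

(* The interval is (a, b], so [primes_in 0 b] lists all primes up to b. *)
Definition primes_in a b := [seq p <- index_iota a.+1 b.+1 | prime p].

Lemma mem_primes_in a b p : (p \in primes_in a b) = [&& prime p, a < p & p <= b].
Proof. by rewrite mem_filter mem_index_iota ltnS. Qed.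

Lemma primes_in_uniq a b : uniq (primes_in a b).
Proof. by rewrite filter_uniq ?iota_uniq. Qed.

Lemma primes_in_cat a b c :
  a <= b -> b <= c -> primes_in a c = primes_in a b ++ primes_in b c.
Proof.
move=> ab bc; rewrite /primes_in -filter_cat; congr seq.filter.
by rewrite /index_iota -[c.+1 - a.+1](@subnKC (b.+1 - a.+1)) ?iotaD;
  [congr (_ ++ iota _ _); lia | lia].
Qed.

Lemma prod_primes_dvd s N :
  uniq s -> all prime s -> all (dvdn^~ N) s -> \prod_(p <- s) p %| N.
Proof.
elim: s => [|p s IHs] /=; first by rewrite big_nil dvd1n.
case/andP=> ps us /andP[pp sp] /andP[pN sN].
rewrite big_cons Gauss_dvd ?pN ?IHs //.
rewrite big_seq; elim/big_rec: _ => [|q x qs]; first exact: coprimen1.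
rewrite coprimeMr => ->; rewrite andbT prime_coprime // dvdn_prime2 //.
  by apply: contraNneq ps => ->.
exact: (allP sp).
Qed.

Lemma prime_dvd_fact p m : prime p -> (p %| m`!) = (p <= m).
Proof.
move=> pp; apply/idP/idP=> [|pm]; last by rewrite dvdn_fact // prime_gt0.
elim: m => [|m IHm].
  by rewrite dvdn1 => /eqP p1; rewrite p1 in pp.
by rewrite factS Euclid_dvdM // => /orP[/dvdn_leq->//|/IHm/leqW].
Qed.

Lemma prod_primes_in_double m : \prod_(p <- primes_in m m.*2) p <= 4 ^ m.
Proof.
apply: (@leq_trans 'C(m.*2, m)); last first.
  by rewrite (_ : 4 = 2 ^ 2) // -expnM mul2n bin_leq_exp2.
apply: dvdn_leq; first by rewrite bin_gt0; lia.
apply: prod_primes_dvd; first exact: primes_in_uniq.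
  by apply/allP=> p; rewrite mem_primes_in => /and3P[].
apply/allP=> p; rewrite mem_primes_in => /and3P[pp mp pm].
(* The prime [p] divides (2m)! = 'C(2m, m) m! m! but not m!, since p > m. *)
have : p %| (m.*2)`! by rewrite dvdn_fact // prime_gt0.
rewrite -(@bin_fact _ m); last by lia.
have -> : m.*2 - m = m by lia.
by rewrite !Euclid_dvdM // prime_dvd_fact // [p <= m]leqNgt mp !orbF.
Qed.

(** Strong induction by halving. With h the half of n rounded up, 16^h * 4^h <= 16^n amounts to 3h
    <= 2n, true for n >= 3; base 16 leaves room for the rounding. *)
Lemma prod_primes_leq n : \prod_(p <- primes_in 0 n) p <= 16 ^ n.
Proof.
elim/ltn_ind: n => n IHn.
case: (leqP n 2) => [n2|n2].
  by move: n n2 {IHn} => [|[|[|//]]] _; rewrite /primes_in /= unlock.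
have nm : n <= (uphalf n).*2 by lia.
have le1 : \prod_(p <- primes_in 0 n) p <= \prod_(p <- primes_in 0 (uphalf n).*2) p.
  rewrite (@primes_in_cat 0 n (uphalf n).*2) // big_cat /=; apply: leq_pmulr.
  rewrite big_seq; apply: prodn_cond_gt0 => p.
  by rewrite mem_primes_in => /and3P[/prime_gt0].
apply: (leq_trans le1).
rewrite (@primes_in_cat 0 (uphalf n)) //; last by lia.
rewrite big_cat /= (leq_trans (leq_mul (IHn _ _) (prod_primes_in_double _))) //.
  by lia.
by rewrite (_ : 16 = 4 ^ 2) // -!expnM -expnD leq_exp2l //; lia.
Qed.

(** Every prime counted is at least z + 1. For z a fixed power of n, logarithms turn this into a
    count O(y / log n). *)
Lemma exp_size_primes_in z y : z.+1 ^ size (primes_in z y) <= 16 ^ y.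
Proof.
case: (leqP z y) => [zy|yz]; last first.
  by rewrite /primes_in /index_iota (_ : _ - _ = 0) ?expn_gt0 //; lia.
apply: leq_trans (prod_primes_leq y).
rewrite (primes_in_cat (leq0n z)) // big_cat /=.
apply: (@leq_trans (\prod_(p <- primes_in z y) p)); last first.
  apply: leq_pmull; rewrite big_seq; apply: prodn_cond_gt0 => p.
  by rewrite mem_primes_in => /and3P[/prime_gt0].
rewrite -iter_muln_1 -count_predT -big_const_seq big_seq [X in _ <= X]big_seq.
by apply: leq_prod => p; rewrite mem_primes_in => /and3P[].
Qed.

(** * Chebyshev's lower bound *)

(** By Legendre's formula the exponent is the sum over k of floor(2m / p^k) - 2 floor(m / p^k). Each
    summand is 0 or 1, and it vanishes once p^k > 2m. *)
Lemma logn_central_bin p m :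
  prime p -> 0 < m -> logn p 'C(m.*2, m) <= trunc_log p m.*2.
Proof.
move=> pp m0; have p1 := prime_gt1 pp.
have C0 : 0 < 'C(m.*2, m) by rewrite bin_gt0; lia.
have := @bin_fact m.*2 m; have -> : m.*2 - m = m by lia.
move=> /(_ ltac:(lia))/(congr1 (logn p)).
rewrite !lognM ?muln_gt0 ?fact_gt0 // addnn => E.
rewrite -(leq_add2r (logn p m`!).*2) E !logn_fact // addnC.
(* The added terms k > m vanish because p^k > m; both Legendre sums now share one range. *)
have -> : \sum_(1 <= k < m.+1) m %/ p ^ k = \sum_(1 <= k < m.*2.+1) m %/ p ^ k.
  rewrite [RHS](@big_cat_nat _ _ _ m.+1) //=; last by lia.
  rewrite [X in _ + X]big_nat_cond [X in _ + X]big1 ?addn0 // => k /andP[/andP[mk _] _].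
  by rewrite divn_small // (ltn_trans mk) // ltn_expl.
apply: (@leq_trans (\sum_(1 <= k < m.*2.+1) ((m %/ p ^ k).*2 + (k <= trunc_log p m.*2)))).
  rewrite !big_nat; apply: leq_sum => k _; rewrite -addnn divnD ?expn_gt0 ?prime_gt0 //.
  rewrite addnn leq_add2l.
  case: (leqP (p ^ k) (m %% p ^ k + m %% p ^ k)) => //= h.
  by rewrite lt0b trunc_log_max // (leq_trans h) // leq_add // leq_mod.
rewrite big_split /= -[X in _ <= X + _]muln2 big_distrl /= leq_add //.
  by apply: leq_sum => k _; rewrite muln2.
rewrite -big_mkcond sum1_count -size_filter -[X in _ <= X](size_iota 1).
apply: uniq_leq_size; first by rewrite filter_uniq ?iota_uniq.
by move=> k; rewrite mem_filter mem_index_iota mem_iota; lia.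
Qed.

Lemma exp2_leq_exp_primes_in m : 0 < m -> 2 ^ m <= m.*2 ^ size (primes_in 0 m.*2).
Proof.
move=> m0; apply: leq_trans (exp2_leq_central_bin m) _.
have C0 : 0 < 'C(m.*2, m) by rewrite bin_gt0; lia.
apply: (@leq_trans (m.*2 ^ size (primes 'C(m.*2, m)))).
  rewrite {1}(prod_prime_decomp C0) prime_decompE big_map /=.
  rewrite -iter_muln_1 -count_predT -big_const_seq big_seq [X in _ <= X]big_seq.
  apply: leq_prod => p; rewrite mem_primes => /and3P[pp _ _].
  apply: leq_trans (trunc_logP (prime_gt1 pp) _); last by rewrite double_gt0.
  by rewrite leq_exp2l ?prime_gt1 // logn_central_bin.
rewrite leq_pexp2l ?double_gt0 //; apply: uniq_leq_size (primes_uniq _) _ => p.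
rewrite mem_primes mem_primes_in => /and3P[pp _ pC]; rewrite pp prime_gt0 //=.
rewrite -(prime_dvd_fact _ pp) -(@bin_fact _ m) ?dvdn_mulr //; lia.
Qed.

(** * The greedy chain and the lower bound criterion *)

(** [b] is the least multiple of [p] strictly above [a]; the seed [a] itself is not part of the
    chain. *)
Fixpoint greedy_chain a ps :=
  if ps is p :: ps' then
    let b := (a %/ p).+1 * p in b :: greedy_chain b ps'
  else [::].

Lemma size_greedy_chain a ps : size (greedy_chain a ps) = size ps.
Proof. by elim: ps a => //= p ps IHps a; rewrite IHps. Qed.

Lemma greedy_chain_path a ps : all prime ps -> path ltn a (greedy_chain a ps).
Proof.
elim: ps a => //= p ps IHps a /andP[pp sp].
by rewrite ltn_ceil ?prime_gt0 // IHps.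
Qed.

Lemma greedy_chain_leq a ps y :
  all (leq^~ y) ps -> all (leq^~ (a + size ps * y)) (greedy_chain a ps).
Proof.
elim: ps a => //= p ps IHps a /andP[py psy].
have le_b : (a %/ p).+1 * p <= a + y.
  by rewrite mulSn addnC leq_add // leq_trunc_div.
apply/andP; split; first by rewrite (leq_trans le_b) // leq_add2l mulSn leq_addr.
apply: sub_all (IHps _ psy) => b /leq_trans; apply.
by rewrite mulSn addnA leq_add2r.
Qed.

Lemma max_pdiv_mulr m p : prime p -> 0 < m <= p -> max_pdiv (m * p) = p.
Proof.
move=> pp /andP[m0 mp]; have mp0 : 0 < m * p by rewrite muln_gt0 m0 prime_gt0.
have mp1 : 1 < m * p by rewrite (leq_trans (prime_gt1 pp)) ?leq_pmull.
apply/eqP; rewrite eqn_leq; apply/andP; split; last first.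
  by apply: max_pdiv_max; rewrite mem_primes pp mp0 dvdn_mull.
have := max_pdiv_dvd (m * p); rewrite Euclid_dvdM ?max_pdiv_prime //.
case/orP=> /dvdn_leq; last by apply; rewrite prime_gt0.
by move=> /(_ m0)/leq_trans; apply.
Qed.

Lemma max_pdiv_greedy_chain n a ps :
  all (fun p => prime p && (n < p ^ 2)) ps -> all (leq^~ n) (greedy_chain a ps) ->
  map max_pdiv (greedy_chain a ps) = ps.
Proof.
elim: ps a => //= p ps IHps a /andP[/andP[pp np] sp] /andP[bn sn].
rewrite IHps // max_pdiv_mulr //=.
(* The term is at most n < p^2, so its cofactor is less than p. *)
by rewrite -(ltn_pmul2r (prime_gt0 pp)) ?leqnn; nia.
Qed.

(** Reduces the lower bound to supplying primes: the greedy chain started at 0 stays within n, and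
    its largest prime factors are exactly [ps]. *)
Lemma g_geq_size n y ps :
  sorted gtn ps -> all (fun p => [&& prime p, p <= y & n < p ^ 2]) ps ->
  size ps * y <= n -> size ps <= g n.
Proof.
move=> gt_ps psP le_n; rewrite -(size_greedy_chain 0); apply: g_max.
have ps_pr : all prime ps by apply: sub_all psP => p /and3P[].
have ps_y : all (leq^~ y) ps by apply: sub_all psP => p /and3P[].
have ps_n : all (fun p => prime p && (n < p ^ 2)) ps.
  by apply: sub_all psP => p /and3P[-> _ ->].
have le_c : all (leq^~ n) (greedy_chain 0 ps).
  by apply: sub_all (greedy_chain_leq 0 ps_y) => b /leq_trans; apply.
have pth := greedy_chain_path 0 ps_pr.
apply/and3P; split; last first.
- by rewrite -(sorted_map (f := max_pdiv) (e' := gtn)) (max_pdiv_greedy_chain ps_n).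
- exact: path_sorted pth.
rewrite all_predI le_c andbT.
exact: order_path_min ltn_trans pth.
Qed.

(** * Counting the terms of an arbitrary chain *)

(** The cutoff [z] lets small values of P be counted trivially, leaving only primes whose logarithm
    will be comparable to log n. *)
Lemma size_chain_leq n s y z :
  P_decreasing_chain n s ->
  size s <= z.+1 + size (primes_in z y) + n %/ y.+1.
Proof.
case/and3P=> /allP s_n lt_s gt_s.
rewrite -(count_predC (fun a => max_pdiv a <= y)) -!size_filter leq_add //.
  rewrite -(size_map max_pdiv) -(size_iota 1 z.+1) -size_cat.
  apply: uniq_leq_size.
    apply: (sorted_uniq (leT := gtn)) => [b a c ab bc|b|]; first exact: ltn_trans bc ab.
      exact: ltnn.
    rewrite sorted_map; apply: sorted_filter gt_s => b a c /= ab bc.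
    exact: ltn_trans bc ab.
  move=> p /mapP[a]; rewrite mem_filter => /andP[ay /s_n/andP[a0 an]] ->.
  rewrite mem_cat mem_iota mem_primes_in ay andbT.
  rewrite max_pdiv_gt0 add1n ltnS.
  (* Values up to z + 1, including [max_pdiv 1 = 1], lie in the initial segment; a larger value
     forces a > 1 and is prime. *)
  case: (leqP _ z.+1) => //= zp; rewrite (ltnW zp) andbT max_pdiv_prime //.
  exact: leq_trans (leq_trans (isT : 1 < z.+2) zp) (max_pdiv_leq a0).
(* [f] is the cofactor. The transitive relation [r] carries both orders to the filtered subsequence,
   where f b <= f a and P(b) < P(a) would give b <= a. *)
pose f a := a %/ max_pdiv a; pose r a b := (a < b) && (max_pdiv b < max_pdiv a).
have r_tr : transitive r.
  move=> b a c /andP[ab pab] /andP[bc pbc].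
  by rewrite /r (ltn_trans ab) // (ltn_trans pbc).
have r_s : sorted r s.
  by elim: s {s_n} lt_s gt_s => // a [|b s] //= IHs /andP[ab lt_s] /andP[pab gt_s];
    rewrite /r ab pab /= IHs.
rewrite -(size_map f) -[X in _ <= X](size_iota 1); apply: uniq_leq_size.
  apply: (sorted_uniq ltn_trans ltnn); rewrite sorted_map.
  apply: sub_sorted (sorted_filter r_tr _ r_s) => a b /andP[ab pab] /=.
  rewrite ltnNge; apply/negP=> /leq_mul/(_ (ltnW pab)).
  by rewrite /f !divnK ?max_pdiv_dvd // leqNgt ab.
move=> q /mapP[a]; rewrite mem_filter mem_iota /= -ltnNge => /andP[ya /s_n/andP[a0 an]] ->.
rewrite add1n ltnS /f divn_gt0 ?max_pdiv_gt0 // max_pdiv_leq //=.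
by rewrite (leq_trans (leq_div2l _ _ ya)) // leq_div2r.
Qed.

(** * Logarithmic form of Chebyshev's bounds, and the scales *)

Local Open Scope ring_scope.

Lemma ln_le_id (R : realType) (x : R) : 0 < x -> ln x <= x.
Proof. by move=> x0; have := @le_ln1Dx R (x - 1); rewrite subrKC; lra. Qed.

(** Both sides come from ln (1 + x) <= x, at x = 1 and x = -1/2. *)
Lemma ln2_bounds (R : realType) : 1 / 2 <= ln (2 : R) <= 1.
Proof.
have h1 : ln (1 + 1) <= 1 :> R by apply: le_ln1Dx; lra.
have h2 : ln (1 + - 2^-1) <= - 2^-1 :> R by apply: le_ln1Dx; lra.
have e2 : 1 + - 2^-1 = 2^-1 :> R by lra.
rewrite e2 lnV ?posrE // in h2.
have e3 : 2 = 1 + 1 :> R by lra.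
by apply/andP; split; [lra | rewrite e3].
Qed.

Lemma ln_expn_le (R : realType) (a b j k : nat) : (0 < a)%N -> (0 < b)%N ->
  (a ^ j <= b ^ k)%N -> j%:R * ln a%:R <= k%:R * ln b%:R :> R.
Proof.
move=> a0 b0 le_ab; rewrite !mulr_natl -!lnXn ?ltr0n // -!natrX.
by rewrite ler_ln ?posrE ?ltr0n ?expn_gt0 ?a0 ?b0 // ler_nat.
Qed.

(** With k primes, n^k <= (z+1)^(4k) <= 16^(4x) = 2^(16x); then ln 2 <= 1. *)
Lemma size_primes_in_le (R : realType) (n x z : nat) : (0 < n <= z.+1 ^ 4)%N ->
  (size (primes_in z x))%:R * ln n%:R <= 16 * x%:R :> R.
Proof.
case/andP=> n0 nz; set k := size _.
have h : (n ^ k <= 2 ^ (16 * x))%N.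
  apply: (@leq_trans (z.+1 ^ (4 * k))).
    by case: k => // k; rewrite expnM leq_exp2r.
  rewrite mulnC expnM (@leq_trans ((16 ^ x) ^ 4)) ?leq_exp2r ?exp_size_primes_in //.
  by rewrite (_ : 16 = 2 ^ 4)%N // -!expnM leq_exp2l //; lia.
have := @ln_expn_le R n 2 _ _ n0 isT h; rewrite natrM.
have /andP[_ l2] := ln2_bounds R; move=> /le_trans; apply.
have x0 : 0 <= x%:R :> R by exact: ler0n.
by rewrite ler_piMr // mulr_ge0.
Qed.

Lemma size_primes_in_ge (R : realType) (n m : nat) : (0 < m)%N -> (m.*2 <= n)%N ->
  m%:R / 2 <= (size (primes_in 0 m.*2))%:R * ln n%:R :> R.
Proof.
move=> m0 mn.
have := @ln_expn_le R 2 _ _ _ isT _ (exp2_leq_exp_primes_in m0).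
rewrite double_gt0 => /(_ m0) h.
have /andP[l2 _] := ln2_bounds R.
have m0' : 0 <= m%:R :> R by exact: ler0n.
have h1 : m%:R / 2 <= m%:R * ln 2 :> R by rewrite ler_wpM2l //; lra.
apply: (le_trans h1); apply: (le_trans h); rewrite ler_wpM2l ?ler0n //.
by rewrite ler_ln ?posrE ?ltr0n ?double_gt0 ?(leq_trans _ mn) ?double_gt0 // ler_nat.
Qed.

(* All sizes are expressed through [u = n ^ (1/4)], [q = (ln n) ^ (1/2)] and
   [s = (n / ln n) ^ (1/2)]; thus [s * q = n ^ (1/2)]. *)
Lemma scales (R : realType) (n : nat) : expR (256 ^+ 2) <= n%:R :> R ->
  exists q u s : R,
  [/\ 256 <= q, 64 * q <= u, s * q = u ^+ 2,
      ln n%:R = q ^+ 2 & n%:R = u ^+ 4 /\ s = (n%:R / ln n%:R) `^ (1 / 2)].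
Proof.
move=> hn.
have n0 : 0 < n%:R :> R by apply: lt_le_trans hn; exact: expR_gt0.
have L256 : 256 ^+ 2 <= ln n%:R :> R.
  by rewrite -[leLHS]expRK ler_ln ?posrE ?expR_gt0.
have L0 : 0 <= ln n%:R :> R by apply: le_trans L256; exact: sqr_ge0.
pose q : R := Num.sqrt (ln n%:R); pose u : R := Num.sqrt (Num.sqrt n%:R).
have q2 : q ^+ 2 = ln n%:R by rewrite sqr_sqrtr.
have q256 : 256 <= q by rewrite -(ler_pXn2r (n := 2)) ?nnegrE ?sqrtr_ge0 // q2.
have u4 : u ^+ 4 = n%:R by rewrite (exprM u 2 2) !sqr_sqrtr ?sqrtr_ge0 ?ler0n.
have u0 : 0 < u by rewrite !sqrtr_gt0.
have q0 : q != 0 by apply/eqP; lra.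
(* Here ln n = 4 ln u <= 4u; together with 256 q <= q^2 this yields 64 q <= u. *)
have q4u : q ^+ 2 <= 4 * u.
  by rewrite q2 -u4 lnXn // -[ln u *+ 4]mulr_natl ler_wpM2l // ln_le_id.
exists q, u, (u ^+ 2 / q); split=> //.
- have : 256 * q <= q ^+ 2 by rewrite expr2 ler_wpM2r //; lra.
  lra.
- by rewrite divfK.
split=> //; rewrite -q2 (_ : n%:R / q ^+ 2 = (u ^+ 2 / q) ^+ 2).
  by rewrite mul1r powR12_sqrt ?sqr_ge0 // sqrtr_sqr ger0_norm // divr_ge0 ?sqr_ge0 ?sqrtr_ge0.
by rewrite expr_div_n -exprM u4.
Qed.

(** * The two bounds on [g] *)

(** Take z near n^(1/4) and y near (n ln n)^(1/2) = s q^2. The primes contribute 16s, the cofactors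
    s, and z + 1 <= 2s, whence 19. *)
Lemma g_le_scale (R : realType) (n : nat) (q u s : R) :
  256 <= q -> 64 * q <= u -> s * q = u ^+ 2 -> ln n%:R = q ^+ 2 ->
  n%:R = u ^+ 4 -> (g n)%:R <= 19 * s.
Proof.
move=> q256 qu sq Lq nu.
have q0 : 0 < q by lra.
have u0 : 0 < u by lra.
have n0 : (0 < n)%N by rewrite -(ltr0n R) nu exprn_gt0.
have s64 : 64 * u <= s by 
  rewrite -(ler_pM2r q0) sq expr2 mulrAC; apply: ler_wpM2r => //; exact: ltW.
have [c <- /size_chain_leq sz] := g_attained n.
pose z := Num.truncn u; pose r := s * q ^+ 2; pose y := Num.truncn r.
have r0 : 0 <= r by rewrite mulr_ge0 ?sqr_ge0 //; lra.
have /andP[zu uz] := truncn_itv (ltW u0).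
have /andP[yr ry] := truncn_itv r0.
have nz : (0 < n <= z.+1 ^ 4)%N.
  by rewrite n0 -(ler_nat R) natrX nu lerXn2r ?nnegrE ?ltW // ltr0n.
have := @size_primes_in_le R _ y _ nz; rewrite Lq => hk.
have k16 : (size (primes_in z y))%:R <= 16 * s.
  have q20 : 0 < q ^+ 2 by rewrite exprn_gt0.
  by rewrite -(ler_pM2r q20) (le_trans hk) // -mulrA ler_wpM2l.
have m1 : (n %/ y.+1)%:R <= s.
  have y0 : 0 < y.+1%:R :> R by rewrite ltr0n.
  rewrite -(ler_pM2r y0) -natrM.
  apply: (@le_trans _ _ n%:R); first by rewrite ler_nat leq_trunc_div.
  have -> : n%:R = s * r by rewrite nu /r; rewrite (exprM u 2 2) -sq; ring.
  by rewrite ler_wpM2l ?ltW //; lra.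
have := sz y z; rewrite -(ler_nat R) !natrD -natr1 => hs.
by apply: (le_trans hs); lra.
Qed.

(** Of at least s/4 primes up to 2M, at most u <= s/64 are up to z and at most s/16 lie in (z, x],
    so s/8 remain above n^(1/2). Rounding s/8 down still leaves s/16. *)
Lemma g_ge_scale (R : realType) (n : nat) (q u s : R) :
  256 <= q -> 64 * q <= u -> s * q = u ^+ 2 -> ln n%:R = q ^+ 2 ->
  n%:R = u ^+ 4 -> 1 / 16 * s <= (g n)%:R.
Proof.
move=> q256 qu sq Lq nu.
have q0 : 0 < q by lra.
have u0 : 0 < u by lra.
have n0 : (0 < n)%N by rewrite -(ltr0n R) nu exprn_gt0.
have s64 : 64 * u <= s by 
  rewrite -(ler_pM2r q0) sq expr2 mulrAC; apply: ler_wpM2r => //; exact: ltW.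
pose w := u ^+ 2; pose r := s * q ^+ 2.
have w0 : 0 <= w by exact: sqr_ge0.
have w2 : n%:R = w ^+ 2 by rewrite nu -exprM.
have rw : r = w * q by rewrite /r /w -sq; ring.
have rs : n%:R = s * r by rewrite w2 /w -sq /r; ring.
have r0 : 0 <= r by rewrite rw mulr_ge0 // ltW.
have uw : u <= w by rewrite /w expr2 ler_peMr //; lra.
have wr : w <= r by rewrite rw ler_peMr //; lra.
pose z := Num.truncn u; pose x := Num.truncn w; pose M := Num.truncn r.
have /andP[zu uz] := truncn_itv (ltW u0).
have /andP[xw wx] := truncn_itv w0.
have /andP[Mr rM] := truncn_itv r0.
have Mpos : (0 < M)%N by rewrite truncn_gt0; lra.
have M2n : (M.*2 <= n)%N.
  by rewrite -(ler_nat R) -muln2 natrM rs mulrC ler_pM //; lra.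
have zx : (z <= x)%N by exact: le_truncn.
have xM : (x <= M.*2)%N by rewrite (leq_trans (le_truncn wr)) // -addnn leq_addr.
have nz : (0 < n <= z.+1 ^ 4)%N.
  by rewrite n0 -(ler_nat R) natrX nu lerXn2r ?nnegrE ?ltW // ltr0n.
have q20 : 0 < q ^+ 2 by rewrite exprn_gt0.
have := @size_primes_in_le R _ x _ nz; rewrite Lq => hk.
have k16 : (size (primes_in z x))%:R <= s / 16.
  rewrite -(ler_pM2r q20) (le_trans hk) //.
  have -> : s / 16 * q ^+ 2 = r / 16 by rewrite /r; ring.
  (* q >= 256 = 16 * 16 turns the Chebyshev bound 16w into r/16. *)
  have : 256 * w <= r by rewrite rw mulrC ler_wpM2l.
  lra.
have := @size_primes_in_ge R _ _ Mpos M2n; rewrite Lq => hM.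
have k4 : s / 4 <= (size (primes_in 0 M.*2))%:R.
  rewrite -(ler_pM2r q20) (le_trans _ hM) //.
  have -> : s / 4 * q ^+ 2 = r / 4 by rewrite /r; ring.
  have : 2 <= r by lra.
  by move: rM; rewrite -natr1; lra.
have kz : (size (primes_in 0 z))%:R <= u.
  apply: le_trans zu; rewrite ler_nat size_filter (leq_trans (count_size _ _)) //.
  by rewrite size_iota subn1.
have k8 : s / 8 <= (size (primes_in x M.*2))%:R.
  move: k4; rewrite (@primes_in_cat 0 x) // (@primes_in_cat 0 z) // !size_cat !natrD.
  lra.
have s80 : 0 <= s / 8 by lra.
pose t := Num.truncn (s / 8); have /andP[ts st] := truncn_itv s80.
(* Only [t] primes are kept, in decreasing order, so that t * 2M <= (s/8) * 2r = n/4. *)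
pose ps := take t (rev (primes_in x M.*2)).
have szps : size ps = t.
  by rewrite size_takel // size_rev -(ler_nat R) (le_trans ts).
have : (size ps <= g n)%N.
  apply: (@g_geq_size n M.*2).
  - apply: take_sorted; rewrite rev_sorted.
    by apply: sorted_filter (iota_ltn_sorted _ _) => b a c; exact: ltn_trans.
  - apply/allP=> p /mem_take; rewrite mem_rev mem_primes_in => /and3P[-> xp ->] /=.
    rewrite -(ltr_nat R) natrX w2 ltrXn2r ?nnegrE //.
    by apply: (lt_le_trans wx); rewrite ler_nat.
  - rewrite szps -(ler_nat R) natrM -muln2 natrM rs.
    rewrite (mulrC M%:R) mulrA ler_pM ?mulr_ge0 //; lra.
rewrite szps -(ler_nat R); apply: le_trans.
by move: st; rewrite -[X in _ < X]natr1 -/t; lra.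
Qed.

Theorem mainTheorem1 (R : realType) :
  exists C1 C2 : R,
    [/\ 0 < C1, 0 < C2 &
      exists N : nat, forall n : nat, (N <= n)%N ->
        C1 * (n%:R / ln n%:R) `^ (1 / 2) <= (g n)%:R
          <= C2 * (n%:R / ln n%:R) `^ (1 / 2)].
Proof.
exists (1 / 16), 19; split; [lra | lra |].
(* This threshold gives ln n >= 256^2, that is q >= 256. *)
exists (Num.truncn (expR (256 ^+ 2 : R))).+1 => n Nn.
have hn : expR (256 ^+ 2) <= n%:R :> R.
  by apply/ltW/(lt_le_trans (truncnS_gt _)); rewrite ler_nat.
have [q [u [s [q256 qu sq Lq [nu <-]]]]] := scales hn.
by rewrite (g_ge_scale q256 qu sq Lq nu) (g_le_scale q256 qu sq Lq nu).
Qed.
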